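(* Let $k$ be a perfect field of characteristic not $2$ with algebraic closure $\bar k$ and $\Gamma=\mathrm{Gal}(\bar k/k)$. Let $G$ be a connected linear algebraic group defined over $k$, and let $t\in G(k)$ be an element which is conjugate to $t^{-1}$ in $G(\bar k)$. Let $H=\mathcal Z_G(t)$ be the centralizer of $t$ in $G$, choose $x\in G(\bar k)$ with $xtx^{-1}=t^{-1}$, and let $\gamma$ be the $1$-cocycle of $\Gamma$ with values in $H(\bar k)$ given by $\gamma(\sigma)=x^{-1}\sigma(x)$ for $\sigma\in\Gamma$. Then $t$ is real in $G(k)$ if and only if $\gamma$ represents the trivial class in $H^1(k,H)$.
   Context: An element $t\in G(k)$ is real in $G(k)$ if there is $h\in G(k)$ with $hth^{-1}=t^{-1}$. $H^1(k,H)$ denotes the (nonabelian) Galois cohomology set $H^1(\Gamma,H(\bar k))$. The class of $\gamma$ is the class of the $H$-torsor $X=\{x\in G\mid xtx^{-1}=t^{-1}\}$, with $H$ acting by $h\cdot x=xh$. *)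

(* Defs.v *)
From HB Require Import structures.
From mathcomp Require Import all_boot all_order all_algebra all_field.
From mathcomp Require Import mpoly.

Set Implicit Arguments.
Unset Strict Implicit.
Unset Printing Implicit Defensive.

Import GRing.Theory.
Local Open Scope ring_scope.

Definition perfect_field (k : fieldType) : Prop :=
  forall p : {poly k}, irreducible_poly p -> separable_poly p.

(* The closed field K, equipped with the embedding iota, is an algebraic
   closure of k. *)
Definition algebraic_closure (k : fieldType) (K : closedFieldType)
    (iota : {rmorphism k -> K}) : Prop :=
  forall a : K, algebraicOver iota a.

Section LinearAlgebraicGroups.

Variables (k : fieldType) (K : closedFieldType) (iota : {rmorphism k -> K}).
Variable n : nat.

(* GL_n as a closed subvariety of affine (n^2 + 1)-space: g is sent to its
   entries followed by 1 / det g, so that evaluation at gl_coord induces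
   K[X_ij, Y] / (Y det X - 1) = K[GL_n]. *)
Definition gl_coord (g : 'M[K]_n) : 'I_(n * n + 1) -> K :=
  fun i => row_mx (mxvec g) (\det g)^-1%:M 0 i.

Definition zariski_closed (C : 'M[K]_n -> Prop) : Prop :=
  exists S : {mpoly K[n * n + 1]} -> Prop, forall g,
    C g <-> g \in unitmx /\ (forall f, S f -> f.@[gl_coord g] = 0).

Definition zariski_connected (C : 'M[K]_n -> Prop) : Prop :=
  forall C1 C2 : 'M[K]_n -> Prop, zariski_closed C1 -> zariski_closed C2 ->
    (forall g, C g -> C1 g \/ C2 g) ->
    (forall g, C g -> ~ (C1 g /\ C2 g)) ->
    (forall g, C g -> C1 g) \/ (forall g, C g -> C2 g).

Definition vanishing_ideal (C : 'M[K]_n -> Prop) (f : {mpoly K[n * n + 1]}) :=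
  forall g, C g -> f.@[gl_coord g] = 0.

(* The ideal of C is generated by its elements with coefficients in k.  The
   equation Y det X - 1 is defined over the prime field, so it is the same to
   ask this in K[X_ij, Y] or in K[GL_n]. *)
Definition defined_over (C : 'M[K]_n -> Prop) : Prop :=
  forall f, vanishing_ideal C f ->
    exists s : seq ({mpoly K[n * n + 1]} * {mpoly k[n * n + 1]}),
      (forall u, u \in s -> vanishing_ideal C (map_mpoly iota u.2)) /\
      f = \sum_(u <- s) u.1 * map_mpoly iota u.2.

(* Linear algebraic groups over k in the classical sense, identified with their
   groups of K-points. *)
Record lin_alg_group : Type := LinAlgGroup {
  lag_pts :> 'M[K]_n -> Prop;
  lag_closed : zariski_closed lag_pts;
  lag_one : lag_pts 1%:M;
  lag_mul : forall g h, lag_pts g -> lag_pts h -> lag_pts (g *m h);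
  lag_inv : forall g, lag_pts g -> lag_pts (invmx g);
  lag_def : defined_over lag_pts
}.

Definition rational_pt (G : lin_alg_group) (g : 'M[k]_n) : Prop :=
  G (map_mx iota g).

Definition real_in (G : lin_alg_group) (t : 'M[k]_n) : Prop :=
  exists h : 'M[k]_n, rational_pt G h /\ h *m t *m invmx h = invmx t.

Lemma lag_unit (G : lin_alg_group) g : G g -> g \in unitmx.
Proof. by case: (lag_closed G) => S /(_ g) [GS _] /GS []. Qed.

End LinearAlgebraicGroups.

Arguments defined_over {k K} iota {n} C.
Arguments lin_alg_group {k K} iota n.

Section GaloisCohomology.

Variables (k : fieldType) (K : closedFieldType) (iota : {rmorphism k -> K}).

(* Gal(K / k). *)
Record absgal : Type := AbsGal {
  absgal_map :> {rmorphism K -> K};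
  absgal_bij : bijective absgal_map;
  absgal_fix : forall a, absgal_map (iota a) = iota a
}.

Fact absgal_mul_bij (s t : absgal) : bijective (s \o t).
Proof. exact: bij_comp (absgal_bij s) (absgal_bij t). Qed.

Fact absgal_mul_fix (s t : absgal) a : (s \o t) (iota a) = iota a.
Proof. by rewrite /= !absgal_fix. Qed.

Definition absgal_mul (s t : absgal) : absgal :=
  @AbsGal (s \o t) (absgal_mul_bij s t) (absgal_mul_fix s t).

(* Krull topology: the automorphisms agreeing with s on a finite subset e of K
   form the coset s Gal(K / k(e)), and these cosets are a base of
   neighbourhoods of s. *)
Definition krull_open (U : absgal -> Prop) : Prop :=
  forall s, U s -> exists e : seq K,
    forall t : absgal, {in e, t =1 s} -> U t.

(* Continuity for the discrete topology on T. *)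
Definition krull_continuous (T : Type) (f : absgal -> T) : Prop :=
  forall A : T -> Prop, krull_open (fun s => A (f s)).

Variable n : nat.

(* Galois-stable subgroups of GL_n(K). *)
Record gal_group : Type := GalGroup {
  gg_pts :> 'M[K]_n -> Prop;
  gg_unit : forall g, gg_pts g -> g \in unitmx;
  gg_one : gg_pts 1%:M;
  gg_mul : forall g h, gg_pts g -> gg_pts h -> gg_pts (g *m h);
  gg_inv : forall g, gg_pts g -> gg_pts (invmx g);
  gg_gal : forall (s : absgal) g, gg_pts g -> gg_pts (map_mx s g)
}.

Record cocycle (H : gal_group) : Type := Cocycle {
  cocycle_fun :> absgal -> 'M[K]_n;
  cocycle_in : forall s, H (cocycle_fun s);
  cocycle_mul : forall s t,
    cocycle_fun (absgal_mul s t) = cocycle_fun s *m map_mx s (cocycle_fun t);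
  cocycle_cont : krull_continuous cocycle_fun
}.

Section H1.

Variable H : gal_group.

Definition cohomologous (a b : cocycle H) : Prop :=
  exists2 h, H h & forall s, b s = invmx h *m a s *m map_mx s h.

Lemma cohomologous_refl a : cohomologous a a.
Proof.
exists 1%:M; first exact: gg_one.
by move=> s; rewrite map_mx1 mulmx1 invmx1 mul1mx.
Qed.

Lemma cohomologous_sym a b : cohomologous a b -> cohomologous b a.
Proof.
case=> h Hh ab; exists (invmx h); first exact: gg_inv.
move=> s; rewrite ab invmxK map_invmx !mulmxA mulmxV ?(gg_unit Hh) // mul1mx.
by rewrite mulmxK // map_unitmx (gg_unit Hh).
Qed.

Lemma cohomologous_trans a b c :
  cohomologous a b -> cohomologous b c -> cohomologous a c.
Proof.
case=> h Hh ab [g Hg bc]; exists (h *m g); first exact: gg_mul.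
have -> : invmx (h *m g) = invmx g *m invmx h.
  have [Uh Ug] := (gg_unit Hh, gg_unit Hg).
  have Uhg : h *m g \in unitmx by rewrite unitmx_mul Uh.
  apply: (can_inj (mulKmx Uhg)).
  by rewrite mulmxV // mulmxA mulmxK // mulmxV.
by move=> s; rewrite bc ab map_mxM !mulmxA.
Qed.

(* The set of cohomology classes of continuous 1-cocycles. *)
Definition H1 : Type :=
  {C : cocycle H -> Prop | exists a, C = cohomologous a}.

Definition H1_class (a : cocycle H) : H1 :=
  exist _ (cohomologous a) (ex_intro _ a erefl).

Fact triv_cocycle_mul (s t : absgal) :
  1%:M = 1%:M *m map_mx s 1%:M :> 'M[K]_n.
Proof. by rewrite map_mx1 mulmx1. Qed.

Fact triv_cocycle_cont : krull_continuous (fun _ => 1%:M : 'M[K]_n).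
Proof. by move=> A s As; exists [::]. Qed.

Definition triv_cocycle : cocycle H :=
  @Cocycle H (fun _ => 1%:M) (fun _ => gg_one H)
    triv_cocycle_mul triv_cocycle_cont.

Definition H1_triv : H1 := H1_class triv_cocycle.

End H1.

Section Centralizer.

Variables (G : lin_alg_group iota n) (t : 'M[k]_n).

Lemma map_gl_coord (s : {rmorphism K -> K}) (g : 'M[K]_n) i :
  gl_coord (map_mx s g) i = s (gl_coord g i).
Proof.
rewrite /gl_coord -(splitK i); case: (split i) => j /=.
  by rewrite !row_mxEl -map_mxvec mxE.
by rewrite !row_mxEr !mxE ord1 eqxx !mulr1n det_map_mx fmorphV.
Qed.

Lemma meval_gal (s : absgal) (p : {mpoly k[n * n + 1]}) g :
  (map_mpoly iota p).@[gl_coord (map_mx s g)]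
    = s (map_mpoly iota p).@[gl_coord g].
Proof.
rewrite !mevalE rmorph_sum; apply: eq_bigr => m _.
rewrite rmorphM rmorph_prod mcoeff_map_mpoly absgal_fix; congr (_ * _).
by apply: eq_bigr => i _; rewrite map_gl_coord rmorphXn.
Qed.

Lemma lag_gal (s : absgal) g : G g -> G (map_mx s g).
Proof.
move=> Gg; have [S clG] := lag_closed G.
apply/clG; split; first by rewrite map_unitmx (lag_unit Gg).
move=> f Sf; have If : vanishing_ideal G f.
  by move=> h /clG [_]; apply.
have [e [Ie ->]] := lag_def If.
rewrite raddf_sum big_seq big1 // => u ue.
by rewrite /= mevalM meval_gal (Ie u ue g Gg) rmorph0 mulr0.
Qed.

Definition centralizer_pts (g : 'M[K]_n) : Prop :=
  G g /\ g *m map_mx iota t = map_mx iota t *m g.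

Lemma map_absgal (s : absgal) (A : 'M[k]_n) :
  map_mx s (map_mx iota A) = map_mx iota A.
Proof. by apply/matrixP=> i j; rewrite !mxE absgal_fix. Qed.

Fact centralizer_unit g : centralizer_pts g -> g \in unitmx.
Proof. by case=> /lag_unit. Qed.

Fact centralizer_one : centralizer_pts 1%:M.
Proof. by split; [exact: lag_one | rewrite mulmx1 mul1mx]. Qed.

Fact centralizer_mul g h :
  centralizer_pts g -> centralizer_pts h -> centralizer_pts (g *m h).
Proof.
case=> Gg gt [Gh ht]; split; first exact: lag_mul.
by rewrite -mulmxA ht mulmxA gt mulmxA.
Qed.

Fact centralizer_inv g : centralizer_pts g -> centralizer_pts (invmx g).
Proof.
case=> Gg gt; have Ug := lag_unit Gg; split; first exact: lag_inv.
by apply: (can_inj (mulKmx Ug)); rewrite mulKVmx // mulmxA gt mulmxK.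
Qed.

Fact centralizer_gal (s : absgal) g :
  centralizer_pts g -> centralizer_pts (map_mx s g).
Proof.
case=> Gg gt; split; first exact: lag_gal.
by rewrite -(map_absgal s) -!map_mxM gt.
Qed.

(* The group of K-points of Z_G(t), with its Galois action. *)
Definition centralizer : gal_group :=
  GalGroup centralizer_unit centralizer_one centralizer_mul
    centralizer_inv centralizer_gal.

Variable x : 'M[K]_n.
Hypothesis Gx : G x.
Hypothesis xt :
  x *m map_mx iota t *m invmx x = invmx (map_mx iota t).

Definition inverting_fun (s : absgal) : 'M[K]_n := invmx x *m map_mx s x.

Fact inverting_in s : centralizer_pts (inverting_fun s).
Proof.
have Ux := lag_unit Gx.
have xt1 : x *m map_mx iota t = invmx (map_mx iota t) *m x.
  by rewrite -xt mulmxKV.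
split; first by apply: lag_mul; [exact: lag_inv | exact: lag_gal].
rewrite /inverting_fun -mulmxA.
have -> : map_mx s x *m map_mx iota t
    = invmx (map_mx iota t) *m map_mx s x.
  rewrite -[X in _ *m X = _](map_absgal s) -map_mxM xt1 map_mxM.
  by rewrite map_invmx map_absgal.
by rewrite -xt !mulmxA mulVmx // mul1mx.
Qed.

Fact inverting_mul s u :
  inverting_fun (absgal_mul s u)
    = inverting_fun s *m map_mx s (inverting_fun u).
Proof.
have Ux := lag_unit Gx.
rewrite /inverting_fun map_mxM map_invmx !mulmxA mulmxK ?map_unitmx //.
by congr (_ *m _); apply/matrixP=> i j; rewrite !mxE.
Qed.

Fact inverting_cont : krull_continuous inverting_fun.
Proof.
move=> A s As; exists [seq x ij.1 ij.2 | ij : 'I_n * 'I_n] => u us.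
suff -> : inverting_fun u = inverting_fun s by [].
congr (_ *m _); apply/matrixP=> i j; rewrite !mxE; apply: us.
by apply/imageP; exists (i, j).
Qed.

Definition inverting_cocycle : cocycle centralizer :=
  @Cocycle centralizer inverting_fun inverting_in inverting_mul inverting_cont.

End Centralizer.

End GaloisCohomology.

(* Main.v *)
Require Import Defs.
From HB Require Import structures.
From mathcomp Require Import all_boot all_order all_algebra all_field.
From mathcomp Require Import mpoly.
From mathcomp Require boolp classical_sets.
Local Open Scope ring_scope.
Import GRing.Theory.

(* If h in G(k) inverts t, then g = x^-1 h lies in H and trivializes gamma;
   conversely, if g in H trivializes gamma, then x g inverts t and is fixed by
   Gamma.  So the theorem reduces to: an element a of K fixed by Gal(K/k) lies
   in k.  If not, its minimal polynomial over k, which is separable, has another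
   root b, and a |-> b extends to an automorphism of K: partial k-isomorphisms
   are encoded by their graphs, which are subrings of K * K, and a maximal one
   (Zorn) is total, as is its inverse. *)

(** * Polynomials of least size and inverses of algebraic elements *)

Lemma exists_min_size (A : nzRingType) (S : {poly A} -> Prop) :
  (exists p, S p) -> exists2 p, S p & forall q, S q -> (size p <= size q)%N.
Proof.
case=> p0 Sp0.
pose ex_size m := boolp.asbool (exists2 p, S p & size p = m).
have exm : exists m, ex_size m.
  by exists (size p0); apply/boolp.asboolP; exists p0.
case: (ex_minnP exm) => m /boolp.asboolP[p Sp szp] minm.
exists p => // q Sq; rewrite szp; apply: minm.
by apply/boolp.asboolP; exists q.
Qed.

Section FixedField.

Set Implicit Arguments.
Unset Strict Implicit.

Variables (k : fieldType) (K : closedFieldType) (iota : {rmorphism k -> K}).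

Local Notation "p ^iota" := (map_poly iota p)
  (at level 2, format "p ^iota") : ring_scope.

(** A nonzero polynomial [g * 'X + c%:P] of least size vanishing at [z] has [c != 0], since
    otherwise the smaller [g] would vanish at [z]; rescaling [g] then gives the inverse. An inverse
    that is a polynomial in [z] over [k] transfers along partial isomorphisms. *)
Lemma algebraic_inv {z} : algebraicOver iota z -> z != 0 ->
  exists g : {poly k}, z * g^iota.[z] = 1.
Proof.
case=> p0 nzp0 p0z nzz.
have [|p [nzp pz] minp] := @exists_min_size _
  (fun p : {poly k} => p != 0 /\ root p^iota z); first by exists p0.
have [g [c pE]] : exists g c, p = g * 'X + c%:P.
  by elim/poly_ind: (p) => [|g c _]; [exists 0, 0 | exists g, c];
    rewrite ?mul0r ?add0r.
have gz : iota c = - (z * g^iota.[z]).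
  apply/eqP; rewrite -addr_eq0 addrC mulrC; move: pz.
  by rewrite pE /root rmorphD rmorphM /= map_polyX map_polyC !hornerE.
have nzc : c != 0.
  apply/eqP => c0; have {pE} pE : p = g * 'X by rewrite pE c0 addr0.
  move/eqP: gz; rewrite c0 rmorph0 eq_sym oppr_eq0 mulf_eq0 (negPf nzz) /=.
  have nzg : g != 0 by apply: contraNneq nzp => g0; rewrite pE g0 mul0r.
  move=> gz; have := minp g (conj nzg gz).
  by rewrite pE size_mulX // ltnn.
exists (- c^-1 *: g).
rewrite map_polyZ /= hornerZ mulrCA -[z * _]opprK -gz rmorphN fmorphV mulrNN.
by rewrite mulVf // fmorph_eq0.
Qed.

(* A subring of K * K containing the diagonal copy of k, seen as the graph of
   an isomorphism between subrings of K: as K is algebraic over k, injectivity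
   of the first projection implies that of the second one, and that both
   projections are subfields. *)
Record partial_iso (R : K * K -> Prop) : Prop := PartialIso {
  piso_iota : forall c, R (iota c, iota c);
  piso_sub : forall z w, R z -> R w -> R (z - w);
  piso_mul : forall z w, R z -> R w -> R (z * w);
  piso_inj : forall y, R (0, y) -> y = 0
}.

(** * Partial isomorphisms and their extension by one element *)

Section PartialIso.

Variables (R : K * K -> Prop) (isoR : partial_iso R).

Lemma piso0 : R 0.
Proof. by have := piso_iota isoR 0; rewrite rmorph0. Qed.

Lemma piso1 : R 1.
Proof. by have := piso_iota isoR 1; rewrite rmorph1. Qed.

Lemma piso_add z w : R z -> R w -> R (z + w).
Proof.
move=> Rz Rw; rewrite -[w]opprK; apply: (piso_sub isoR) => //.
by rewrite -sub0r; apply: (piso_sub isoR) => //; apply: piso0.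
Qed.

Lemma piso_coef_mul (P Q : {poly K * K}) :
  (forall i, R P`_i) -> (forall i, R Q`_i) -> forall i, R (P * Q)`_i.
Proof.
move=> RP RQ i; rewrite coefM.
apply: (big_ind R); [exact: piso0 | exact: piso_add |].
by move=> j _; apply: (piso_mul isoR).
Qed.

Lemma piso_horner (g : {poly k}) z :
  R z -> R (g^iota.[z.1], g^iota.[z.2]).
Proof.
move=> Rz; elim/poly_ind: g => [|g c Rg].
  by rewrite rmorph0 !horner0; apply: piso0.
rewrite rmorphD rmorphM /= map_polyX map_polyC !hornerE.
by have := piso_add (piso_mul isoR Rg Rz) (piso_iota isoR c).
Qed.

Hypothesis algK : algebraic_closure iota.

Lemma piso_inv {z} : R z -> z.1 != 0 -> exists2 w, R w & z * w = 1.
Proof.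
move=> Rz nz1; have [g gz] := algebraic_inv (algK z.1) nz1.
pose w := (g^iota.[z.1], g^iota.[z.2]).
have Rw : R w by apply: piso_horner.
(* [z * w - 1] lies in [R] and has first coordinate 0, so [piso_inj] kills the second one too. *)
exists w => //; apply/eqP; rewrite -subr_eq0; apply/eqP.
have := piso_sub isoR (piso_mul isoR Rz Rw) piso1.
have : (z * w - 1).1 = 0 by rewrite /= gz subrr.
by case: (z * w - 1) => _ y /= -> /(piso_inj isoR) ->.
Qed.

(** If [y] were nonzero, [(y, 0)] would have an inverse in [R], and second coordinates would give 0
    = 1. *)
Lemma piso_inj2 y : R (y, 0) -> y = 0.
Proof.
move=> Ry; apply: contraTeq (oner_neq0 K) => nzy.
have [w Rw] := piso_inv Ry nzy => /(congr1 snd) /= <-.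
by rewrite mul0r eqxx.
Qed.

Lemma piso_swap : partial_iso (fun z => R (z.2, z.1)).
Proof.
split=> [c|z w Rz Rw|z w Rz Rw|y /piso_inj2//]; first exact: piso_iota.
  exact: (piso_sub isoR Rz Rw).
exact: (piso_mul isoR Rz Rw).
Qed.

Lemma piso_fun u v v' : R (u, v) -> R (u, v') -> v = v'.
Proof.
move=> Rv Rv'; apply/eqP; rewrite -subr_eq0; apply/eqP/(piso_inj isoR).
by rewrite -(subrr u); apply: (piso_sub isoR Rv Rv').
Qed.

Lemma piso_fst_neq0 z : R z -> z != 0 -> z.1 != 0.
Proof.
case: z => z1 z2 Rz; apply: contraNneq => /= z10.
by rewrite z10 in Rz *; rewrite (piso_inj isoR Rz).
Qed.

(* If P is a minimal equation of u over the domain of R, every root v of the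
   conjugate equation is a possible image for u: the extension consists of the
   values at (u, v) of the polynomials over R. *)
Lemma piso_extend (u v : K) (P : {poly K * K}) :
    P != 0 -> (forall i, R P`_i) ->
    (forall Q : {poly K * K}, Q != 0 -> (forall i, R Q`_i) ->
       root (map_poly fst Q) u -> (size P <= size Q)%N) ->
    root (map_poly fst P) u -> root (map_poly snd P) v ->
  exists R', [/\ partial_iso R', forall z, R z -> R' z & R' (u, v)].
Proof.
move=> nzP RP minP Pu Pv.
have evE (Q : {poly K * K}) :
    Q.[(u, v)] = ((map_poly fst Q).[u], (map_poly snd Q).[v]).
  rewrite [LHS]surjective_pairing.
  by rewrite -(horner_map fst Q (u, v)) -(horner_map snd Q (u, v)).
have P0 : P.[(u, v)] = 0 by rewrite evE (rootP Pu) (rootP Pv).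
(* [K * K] has zero divisors, but the nonzero elements of [R] are invertible in [R]. *)
have [w Rw wP] : exists2 w, R w & lead_coef P * w = 1.
  have Rc : R (lead_coef P) by apply: RP.
  by apply: piso_inv => //; apply: piso_fst_neq0 => //; rewrite lead_coef_eq0.
(* Division by [P], one step at a time: subtracting [M * P] cancels the leading term of [Q], keeps
   the coefficients in [R] and preserves the value at [(u, v)]. By minimality of [P] the descent
   stops only at 0. *)
have vanish (Q : {poly K * K}) :
    (forall i, R Q`_i) -> root (map_poly fst Q) u -> Q.[(u, v)] = 0.
  have [m] := ubnP (size Q); elim: m Q => // m IHm Q ltQm RQ Qu.
  have [-> | nzQ] := eqVneq Q 0; first by rewrite horner0.
  have leszPQ := minP Q nzQ RQ Qu.
  pose M := (w * lead_coef Q) *: 'X^(size Q - size P) : {poly K * K}.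
  have RM i : R M`_i.
    rewrite coefZ coefXn; apply: (piso_mul isoR).
      by apply: (piso_mul isoR) => //; apply: RQ.
    by case: eqP => _; [apply: piso1 | apply: piso0].
  have RMP := piso_coef_mul RM RP.
  have -> : Q = (Q - M * P) + M * P by rewrite subrK.
  rewrite hornerD hornerM P0 mulr0 addr0; apply: IHm.
  - rewrite -ltnS; apply: leq_trans ltQm; rewrite ltnS.
    have szP : (0 < size P)%N by rewrite size_poly_gt0.
    have szQ := leq_trans szP leszPQ.
    rewrite -(prednK szQ) ltnS; apply/leq_sizeP => j.
    have lePQ : (size Q - size P <= (size Q).-1)%N.
      by rewrite -subn1 leq_sub2l.
    rewrite coefB -scalerAl coefZ coefXnM leq_eqVlt => /predU1P[<- | ltQj].
      have -> : ((size Q).-1 - (size Q - size P) = (size P).-1)%N.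
        by rewrite -subn1 subnAC subKn // subn1.
      rewrite ltnNge lePQ /= -![_`_ _.-1]/(lead_coef _).
      by rewrite mulrAC [w * _]mulrC wP mul1r subrr.
    rewrite (prednK szQ) in ltQj.
    have lePj : (size P <= j - (size Q - size P))%N.
      by rewrite leq_subRL ?subnK // (leq_trans (leq_subr _ _)).
    by rewrite !nth_default // if_same mulr0 subr0.
  - by move=> i; rewrite coefB; apply: (piso_sub isoR).
  - rewrite /root rmorphB rmorphM /= hornerD hornerN hornerM.
    by rewrite (rootP Qu) (rootP Pu) mulr0 subr0.
pose R' z := exists2 Q : {poly K * K}, (forall i, R Q`_i) & z = Q.[(u, v)].
have RC z : R z -> forall i, R z%:P`_i.
  by move=> Rz i; rewrite coefC; case: eqP => // _; apply: piso0.
exists R'; split; last first.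
- exists 'X; last by rewrite hornerX.
  by move=> i; rewrite coefX; case: eqP => _; [apply: piso1 | apply: piso0].
- by move=> z Rz; exists z%:P; [apply: RC | rewrite hornerC].
split=> [c|_ _ [Q RQ ->] [S RS ->]|_ _ [Q RQ ->] [S RS ->]|y [Q RQ Qy]].
- exists (iota c, iota c)%:P; last by rewrite hornerC.
  exact: RC (piso_iota isoR c).
- exists (Q - S); last by rewrite !hornerE.
  by move=> i; rewrite coefB; apply: (piso_sub isoR).
- exists (Q * S); last by rewrite hornerM.
  exact: piso_coef_mul RQ RS.
(* Injectivity for [R']: a value [(0, y)] comes from some [Q] whose first projection has the root
   [u], so [vanish] applies. *)
have /vanish := RQ; rewrite -Qy => Q0.
suff /Q0[] : root (map_poly fst Q) u by [].
by move: Qy; rewrite evE /root => -[<- _].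
Qed.

Definition maximal_piso := forall R', partial_iso R' ->
  (forall z, R z -> R' z) -> forall z, R' z -> R z.

(** Take a least equation [P] of [u] over [R]. Both coordinates of its leading coefficient are
    nonzero, so its two projections have the same degree and the second has a root [v] in [K].
    Maximality puts [(u, v)] in [R]. *)
Lemma maximal_piso_total : maximal_piso -> forall u, exists v, R (u, v).
Proof.
move=> maxR u.
have [p0 nzp0 p0u] := algK u.
pose S (P : {poly K * K}) :=
  [/\ P != 0, forall i, R P`_i & root (map_poly fst P) u].
have [|P [nzP RP Pu] minP] := @exists_min_size _ S.
  pose P0 : {poly K * K} := \poly_(i < size p0) (iota p0`_i, iota p0`_i).
  have P0E : map_poly fst P0 = p0^iota.
    apply/polyP=> i; rewrite !coef_map /= coef_poly; case: ltnP => // lei.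
    by rewrite nth_default // !rmorph0.
  exists P0; split; last by rewrite P0E.
    apply: contraNneq nzp0 => P00; rewrite -(map_poly_eq0 iota) -P0E P00.
    by rewrite map_poly0.
  move=> i; rewrite coef_poly; case: ifP => _; first exact: piso_iota.
  exact: piso0.
have nz1 : (lead_coef P).1 != 0.
  by apply: piso_fst_neq0; rewrite ?lead_coef_eq0 //; apply: RP.
have nz2 : (lead_coef P).2 != 0.
  move: nz1 (RP (size P).-1); rewrite -[_`_ _]/(lead_coef P).
  case: (lead_coef P) => y z /= nzy Ryz.
  by apply: contraNneq nzy => z0; rewrite z0 in Ryz; rewrite (piso_inj2 Ryz).
have /closed_rootP[v Pv] : size (map_poly snd P) != 1.
  rewrite (size_map_poly_id0 nz2) -(size_map_poly_id0 nz1) neq_ltn orbC.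
  by rewrite (root_size_gt1 _ Pu) // -size_poly_gt0 (size_map_poly_id0 nz1)
    size_poly_gt0.
have [|R' [isoR' leRR' R'uv]] := piso_extend nzP RP _ Pu Pv.
  by move=> Q nzQ RQ Qu; apply: minP.
by exists v; apply: maxR leRR' _ R'uv.
Qed.

End PartialIso.

(** * Maximal partial isomorphisms and automorphisms of [K] *)

Lemma exists_maximal_piso R0 : partial_iso R0 -> exists R,
  [/\ partial_iso R, forall z, R0 z -> R z & maximal_piso R].
Proof.
move=> isoR0.
(* The guard admits the empty set, which is the union of the empty chain. *)
pose P (R : K * K -> Prop) := (exists z, R z) ->
  partial_iso R /\ forall z, R0 z -> R z.
have [|R [PR maxR]] := @classical_sets.Zorn_bigcup _ P.
  move=> F FP totF [z0 [A0 FA0 A0z0]].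
  have [_ leR0A] := FP _ FA0 (ex_intro _ _ A0z0).
  have isoF A z : F A -> A z -> partial_iso A.
    by move=> FA Az; case: (FP _ FA (ex_intro _ _ Az)).
  have isoA0 := isoF _ _ FA0 A0z0.
  have joinF z w A B : F A -> A z -> F B -> B w ->
      exists2 C, F C & C z /\ C w.
    move=> FA Az FB Bw; have [leAB | leBA] := totF _ _ FA FB.
      by exists B => //; split=> //; apply: leAB.
    by exists A => //; split=> //; apply: leBA.
  split; last by move=> z R0z; exists A0 => //; apply: leR0A.
  split=> [c | z w [A FA Az] [B FB Bw] | z w [A FA Az] [B FB Bw] | y [A FA Ay]].
  - by exists A0 => //; apply: (piso_iota isoA0 c).
  - have [C FC [Cz Cw]] := joinF _ _ _ _ FA Az FB Bw.
    by exists C => //; apply: (piso_sub (isoF _ _ FC Cz) Cz Cw).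
  - have [C FC [Cz Cw]] := joinF _ _ _ _ FA Az FB Bw.
    by exists C => //; apply: (piso_mul (isoF _ _ FC Cz) Cz Cw).
  - exact: (piso_inj (isoF _ _ FA Ay) Ay).
(* The empty set is not maximal: [R0] lies strictly above it. *)
have [z Rz] : exists z, R z.
  apply: boolp.contrapT => R_0; apply: (maxR R0); last by [].
  split=> [z Rz | leR0R]; first by case: R_0; exists z.
  by apply: R_0; exists 0; apply: leR0R; apply: piso0 isoR0.
have [isoR leR0R] := PR (ex_intro _ z Rz).
exists R; split=> // R' isoR' leRR' w R'w; apply: boolp.contrapT => notRw.
apply: (maxR R'); first by split=> // leR'R; apply/notRw/leR'R.
by move=> _; split=> // y /leR0R /leRR'.
Qed.

(** A maximal [R] above [R0] is total and single-valued, and so is its swap, which is maximal as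
    well. Hence [R] is the graph of a bijection [f], with inverse [g]. *)
Lemma piso_automorphism R0 : algebraic_closure iota -> partial_iso R0 ->
  exists s : absgal iota, forall u v, R0 (u, v) -> s u = v.
Proof.
move=> algK /exists_maximal_piso[R [isoR leR0R maxR]].
have isoR1 := piso_swap isoR algK.
have maxR1 : maximal_piso (fun z => R (z.2, z.1)).
  move=> R' isoR' leRR' z R'z.
  apply: (maxR _ (piso_swap isoR' algK)) => [[u v] Ruv|] /=.
    exact: leRR'.
  by case: z R'z.
have [f Rf] := boolp.choice (maximal_piso_total isoR algK maxR).
have [g Rg] := boolp.choice (maximal_piso_total isoR1 algK maxR1).
have fE u v : R (u, v) -> f u = v by apply: (piso_fun isoR).
have fB : zmod_morphism f.
  by move=> u v; apply: fE; apply: (piso_sub isoR (Rf u) (Rf v)).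
have fM : monoid_morphism f.
  split; first by apply: fE; apply: (piso1 isoR).
  by move=> u v; apply: fE; apply: (piso_mul isoR (Rf u) (Rf v)).
pose fR : {rmorphism K -> K} := HB.pack f
  (GRing.isZmodMorphism.Build K K f fB) (GRing.isMonoidMorphism.Build K K f fM).
have f_bij : bijective fR.
  exists g => [u | v]; last exact: fE (Rg v).
  exact: (piso_fun isoR1 (Rg (f u)) (Rf u)).
have f_fix c : fR (iota c) = iota c by apply: fE; apply: (piso_iota isoR).
by exists (AbsGal f_bij f_fix) => u v /leR0R; apply: fE.
Qed.

(** * The fixed field of the Galois group *)

Lemma absgal_fixed : perfect_field k -> algebraic_closure iota ->
  forall a, (forall s : absgal iota, s a = a) -> exists c, a = iota c.
Proof.
move=> kperf algK a fix_a.
have [|p [nzp pa] minp] := @exists_min_size _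
  (fun p : {poly k} => p != 0 /\ root p^iota a).
  by have [p] := algK a; exists p.
have min_dvd q : root q^iota a -> p %| q.
  move=> qa; apply: contraT; rewrite /dvdp => nzr.
  suff /(conj nzr)/minp : root (q %% p)^iota a by rewrite leqNgt ltn_modp nzp.
  move: qa; rewrite {1}(divp_eq q p) /root rmorphD rmorphM /= hornerD hornerM.
  by rewrite (rootP pa) mulr0 add0r.
have szp : (1 < size p)%N.
  by rewrite -(size_map_poly iota) (root_size_gt1 _ pa) // map_poly_eq0.
(* If p = r q with q nonconstant, then [a] is a root of r, which is too small, or of q, which [p]
   then divides. *)
have irr_p : irreducible_poly p.
  split=> // q szq /[dup] qp /dvdpP[r pE].
  have nzr : r != 0 by apply: contraNneq nzp => r0; rewrite pE r0 mul0r.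
  have nzq : q != 0 by apply: contraNneq nzp => q0; rewrite pE q0 mulr0.
  move: pa; rewrite pE rmorphM rootM => /orP[ra | qa].
    have := minp r (conj nzr ra); rewrite pE size_mul //.
    have : (1 < size q)%N by rewrite ltn_neqAle eq_sym szq size_poly_gt0.
    case: (size q) => [|[|m]] // _; rewrite !addnS /=.
    by rewrite leqNgt ltnS leq_addr.
  by rewrite -pE /eqp qp min_dvd.
have [sz2 | szp2] := eqVneq (size p) 2.
  exists (- (p`_0 / p`_1)); move: pa; rewrite /root horner_coef size_map_poly.
  rewrite sz2 2!big_ord_recl big_ord0 /= !coef_map /= expr0 mulr1 addr0 expr1.
  have nzp1 : iota p`_1 != 0.
    by have := lead_coef_eq0 p; rewrite lead_coefE sz2 fmorph_eq0 => ->.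
  rewrite addrC addr_eq0 rmorphN fmorph_div /= -mulNr => /eqP <-.
  by rewrite mulrAC mulfV // mul1r.

have /factor_theorem[q pE] := pa.
(* Separability makes [a] a simple root, so [q] does not vanish at [a] and every root [b] of [q]
   differs from [a]. *)
have : separable_poly p^iota by rewrite separable_map; apply: kperf.
rewrite pE separable_root => /andP[_ nqa].
have /closed_rootP[b qb] : size q != 1.
  have nzq : q != 0.
    by apply: contraNneq nzp => q0; rewrite -(map_poly_eq0 iota) pE q0 mul0r.
  apply: contra_neq szp2 => szq; rewrite -(size_map_poly iota) pE.
  by rewrite size_mul ?polyXsubC_eq0 // size_XsubC szq.
have pb : root p^iota b by rewrite pE rootM qb.
(* The graph of the isomorphism from k(a) to k(b) sending [a] to [b]; it is well defined because [p]
   divides every polynomial over [k] vanishing at [a]. *)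
pose R0 z := exists g : {poly k}, z = (g^iota.[a], g^iota.[b]).
have isoR0 : partial_iso R0.
  split=> [c | _ _ [g ->] [h ->] | _ _ [g ->] [h ->] | y [g [ga ->]]].
  - by exists c%:P; rewrite map_polyC !hornerC.
  - by exists (g - h); rewrite rmorphB !hornerE.
  - by exists (g * h); rewrite rmorphM !hornerM.
  have /dvdpP[h ->] : p %| g by apply: min_dvd; rewrite /root -ga.
  by rewrite rmorphM hornerM (rootP pb) mulr0.
have [s sE] := piso_automorphism algK isoR0.
case/negP: nqa; rewrite -(fix_a s) (sE a b) //.
by exists 'X; rewrite map_polyX !hornerX.
Qed.

End FixedField.

(** * Cohomology classes and descent of the inverting element *)

Lemma H1_class_eq (k : fieldType) (K : closedFieldType)
    (iota : {rmorphism k -> K}) n (H : gal_group iota n) (a b : cocycle H) :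
  H1_class a = H1_class b <-> cohomologous a b.
Proof.
split=> [/(congr1 (@proj1_sig _ _)) /= -> | ab]; first exact: cohomologous_refl.
apply: boolp.eq_exist; apply: boolp.funext => c; apply: boolp.propext.
split; last exact: cohomologous_trans ab.
exact: cohomologous_trans (cohomologous_sym ab).
Qed.

Theorem proposition2p2p2
    (k : fieldType) (kbar : closedFieldType) (iota : {rmorphism k -> kbar})
    (kperf : perfect_field k) (kchar : 2%N \notin [pchar k])
    (kbarP : algebraic_closure iota)
    (n : nat) (G : lin_alg_group iota n) (Gconn : zariski_connected G)
    (t : 'M[k]_n) (Gt : rational_pt G t)
    (x : 'M[kbar]_n) (Gx : G x)
    (xt : x *m map_mx iota t *m invmx x = invmx (map_mx iota t)) :
  real_in G t <->
  H1_class (inverting_cocycle Gx xt) = H1_triv (centralizer G t).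
Proof.
rewrite /H1_triv H1_class_eq.
have Ux := lag_unit Gx.
have xtE : x *m map_mx iota t = invmx (map_mx iota t) *m x.
  by rewrite -xt mulmxKV.
split=> [[h [Gh ht]] | [g [Gg gt] gE]].
  set hK := map_mx iota h; have Uh : hK \in unitmx := lag_unit Gh.
  have htE : hK *m map_mx iota t = invmx (map_mx iota t) *m hK.
    by rewrite -map_invmx -ht !map_mxM map_invmx mulmxKV.
  exists (invmx x *m hK) => [|s /=].
    split; first by apply: lag_mul => //; apply: lag_inv.
    rewrite -mulmxA htE; apply: (can_inj (mulKmx Ux)).
    by rewrite !mulmxA xtE mulmxV // mul1mx mulmxK.
  (* As [s] fixes [hK], the factors s(x) and s(x)^-1 cancel. *)
  rewrite /inverting_fun map_mxM map_invmx map_absgal !mulmxA.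
  rewrite mulmxK ?map_unitmx // -[_ *m invmx x *m hK]mulmxA mulVmx //.
  by rewrite unitmx_mul unitmx_inv Ux.
have Ug := lag_unit Gg.
(* Multiply 1 = g^-1 x^-1 s(x) s(g) on the left by x g. *)
have fixxg (s : absgal iota) : map_mx s (x *m g) = x *m g.
  have /= := gE s; rewrite /inverting_fun map_mxM => /(congr1 (mulmx (x *m g))).
  by rewrite mulmx1 !mulmxA mulmxK // mulmxV // mul1mx.
(* A Galois-fixed matrix descends to [k] entry by entry. *)
have [f fE] : exists f, forall ij, (x *m g) ij.1 ij.2 = iota (f ij).
  suff /boolp.choice[f fE] :
      forall ij : 'I_n * 'I_n, exists c, (x *m g) ij.1 ij.2 = iota c by exists f.
  case=> i j; apply: absgal_fixed => // s /=.
  by rewrite -{2}(fixxg s) [in RHS]mxE.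
pose h := \matrix_(i, j) f (i, j).
have hE : map_mx iota h = x *m g.
  by apply/matrixP=> i j; rewrite !mxE -fE !mxE.
have Uh : h \in unitmx by rewrite -(map_unitmx iota) hE unitmx_mul Ux.
exists h; split; first by rewrite /rational_pt hE; apply: lag_mul.
apply: (can_inj (mulmxK Uh)); rewrite mulmxKV //.
apply: (@map_mx_inj _ _ iota); rewrite !map_mxM map_invmx hE.
by rewrite -mulmxA gt mulmxA xtE mulmxA.
Qed.
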